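(* Let $\lambda$ be a cardinal number and $\{X_\alpha:\alpha<\lambda\}$ a family of Tychonoff spaces such that for every $\alpha<\lambda$ and $\beta<\lambda$: (1) $\mathsf{C}(C_p(X_\alpha))=\{\kappa:\kappa\text{ is an infinite cardinal and }\mathrm{cf}(\kappa)>|X_\alpha|\}$; (2) $X_\alpha$ is homeomorphic to $X_\beta$ whenever $|X_\alpha|=|X_\beta|$; and (3) if $I_\alpha:=\{\gamma<\lambda:|X_\gamma|=|X_\alpha|\}$, then $|X_\alpha|\cdot|I_\alpha|=|X_\alpha|$. Then $$\mathsf{C}\Big(C_p\Big(\bigoplus_{\alpha<\lambda}X_\alpha\Big)\Big)=\bigcap_{\alpha<\lambda}\mathsf{C}(C_p(X_\alpha)).$$
   Context: $\bigoplus$ denotes the topological sum (disjoint union). For a Tychonoff space $X$, $C_p(X)$ is the set of continuous functions $X\to\mathbb{R}$ with the topology of pointwise convergence (the subspace topology from $\mathbb{R}^X$). An infinite cardinal $\kappa$ is a caliber for a space $Z$ if for every set $I$ with $|I|=\kappa$ and every indexed family $\{U_\alpha:\alpha\in I\}$ of nonempty open subsets of $Z$ there is $J\subseteq I$ with $|J|=\kappa$ and $\bigcap_{\alpha\in J}U_\alpha\neq\emptyset$. $\mathsf{C}(Z)$ denotes the class of all infinite cardinals that are calibers for $Z$. *)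

(* Defs.v *)
From HB Require Import structures.
From mathcomp Require Import all_boot all_order all_algebra.
From mathcomp Require Import all_classical all_reals all_analysis.

Set Implicit Arguments.
Unset Strict Implicit.
Unset Printing Implicit Defensive.

Import Order.TTheory GRing.Theory Num.Theory.
Import numFieldNormedType.Exports.

Local Open Scope classical_set_scope.
Local Open Scope order_scope.
Local Open Scope card_scope.

(* A cardinal is an initial ordinal: a well-ordered set that is not equipotent
   to any of its proper initial segments. The elements of [k] are the ordinals
   below [k]. Since [orderType] extends [choiceType], families indexed by a
   cardinal can be summed with the [sigT] topology. *)
Record cardinal := Cardinal {
  cardinal_sort :> orderType Order.default_display;
  cardinal_wf : forall A : set cardinal_sort, A !=set0 ->
    exists2 x, A x & forall y, A y -> x <= y;
  cardinal_initial : forall x : cardinal_sort,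
    ~ ([set: cardinal_sort] #<= [set y | y < x]) }.

(* [cardinal] is too large for [set cardinal] to be well-typed; classes of
   cardinals are therefore plain predicates. *)
Definition infinite_cardinal (k : cardinal) : Prop := infinite_set [set: k].

Definition card_lt (S T : Type) (A : set S) (B : set T) :=
  A #<= B /\ ~ (B #<= A).

Definition cofinal (k : cardinal) (C : set k) :=
  forall x, exists2 y, C y & x <= y.

(* The cofinality of [k] is the least cardinality of a cofinal subset; as with
   [card_le], it is represented by a set having that cardinality. *)
Definition is_cofinality (k : cardinal) (C : set k) :=
  cofinal C /\ forall D : set k, cofinal D -> C #<= D.

Definition cofinality_gt (S : Type) (k : cardinal) (A : set S) :=
  exists2 C : set k, is_cofinality C & card_lt A C.

Definition tychonoff_space (X : topologicalType) :=
  completely_regular_space X /\ hausdorff_space X.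

Definition homeomorphic (X Y : topologicalType) :=
  exists f : X -> Y, exists g : Y -> X,
    [/\ continuous f, continuous g, cancel f g & cancel g f].

(* [{ptws X -> R}] is the product R^X, and the coercion of a set to a type
   carries the subspace topology. *)
Definition Cp (R : realType) (X : topologicalType) : topologicalType :=
  [set f : {ptws X -> R} | continuous (f : X -> R)].

(* [calibers Z] is the class C(Z): only infinite cardinals belong to it. *)
Definition calibers (Z : topologicalType) (k : cardinal) : Prop :=
  infinite_cardinal k /\
  forall (I : Type) (U : I -> set Z), [set: I] #= [set: k] ->
    (forall i, open (U i) /\ U i !=set0) ->
    exists2 J : set I, J #= [set: k] & \bigcap_(i in J) U i !=set0.

(* Main.v *)
Require Import Defs.
From HB Require Import structures.
From mathcomp Require Import all_boot all_order all_algebra.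
From mathcomp Require Import lra.
From mathcomp Require Import all_classical all_reals all_analysis.

(** Restriction to a summand is a continuous surjection between function
    spaces, so calibers of the sum are calibers for every summand. For the
    converse, let k be a caliber of every [Cp R (X a)] and let C be a cofinal
    subset of k of least cardinality. Then |X a| < |C| for all a by the
    description of these calibers. Moreover C is uncountable as soon as some
    X a has a point y, since the sets of functions f with f y in ]n, n+1[ rule
    out countable cofinality ([uncountable_cofinality]).

    Write an open set as a finite list of constraints p < f y < q with
    rational p and q ([in_box_nbhs]). Say that an ideal of subsets of k is
    additive over A when it is closed under unions indexed by A; this is
    a pigeonhole principle, and for ideals closed under countable unions it
    passes from A to the finite sequences of elements of A. The ideal of non-cofinal subsets of k is additive over
    every set that C does not inject into ([additive_not_cofinal]).

    The core is [cofinal_common_function]: given a constraint list for each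
    index in k, every list satisfied by some continuous function,
    a single continuous function satisfies the lists of cofinally many
    indices. The delta-system lemma makes the finite sets of summands met by
    the lists pairwise disjoint outside a finite set Q of summands. The part
    of a list inside Q ranges over a set of size less than |C|, so it can be
    made constant. Finally the functions are glued: one fixed function on the
    summands in Q, and on every other summand the function of the only index
    whose list mentions it.

    If k is regular, a cofinal set of indices has cardinality k. If k is
    singular, there are at most |C| < k cardinalities among the nonempty X a,
    and each one is attained by at most as many summands as there are points
    in one of them; so the sum has at most |C| points, and for each c in k some
    constraint list is shared by more than |c| indices
    ([constant_on_large_sets]). Applying the core to these lists indexed by
    c yields a function lying in at least |c| of the given open sets for
    cofinally many c, hence in k of them. *)

Set Implicit Arguments.
Unset Strict Implicit.
Unset Printing Implicit Defensive.

Import Order.TTheory GRing.Theory Num.Theory.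
Import numFieldNormedType.Exports.

Local Open Scope classical_set_scope.
Local Open Scope card_scope.

(** * Comparison of sets with a cardinal *)

Lemma injective_card_le T U (A : set T) (B : set U) (f : T -> U) :
  (forall x, A x -> B (f x)) ->
  (forall x y, A x -> A y -> f x = f y -> x = y) -> A #<= B.
Proof.
move=> fB finj; have [g] : $|{injfun A >-> B}|.
  apply/injfunPex; exists f => // x y /set_mem Ax /set_mem Ay; exact: finj.
exact: inj_card_le.
Qed.

Lemma card_le_inj T U (A : set T) (B : set U) : A #<= B -> A !=set0 ->
  exists f : T -> U, (forall x, A x -> B (f x)) /\
    (forall x y, A x -> A y -> f x = f y -> x = y).
Proof.
elim/Ppointed: U => U in B *.
  by rewrite card_le_emptyr => /eqP -> [].
move=> /pcard_leP/injfunPex[f fB finj] _; exists f; split => //.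
by move=> x y Ax Ay; apply: finj; exact: mem_set.
Qed.

Definition below (k : cardinal) (x : k) : set k := [set y | (y < x)%O].

Lemma cardinal_lt_wf (k : cardinal) :
  well_founded (fun x y : k => (x < y)%O).
Proof.
apply: contrapT => /existsNP[x0 nx0].
have [|x nx xmin] := @cardinal_wf k
  [set x | ~ Acc (fun x y : k => (x < y)%O) x]; first by exists x0.
apply: nx; constructor => y yx; apply: contrapT => ny.
by have := xmin _ ny; rewrite leNgt yx.
Qed.

(** Enumerate A by transfinite recursion along k, choosing at each step an
    element of A that does not yet occur. Either there is a new element at every
    step, or A is exhausted at some x. *)
Lemma card_segment (k : cardinal) T (A : set T) :
  [set: k] #<= A \/ exists x : k, below x #= A.
Proof.
elim/Pchoice: T => T in A *.
have [->|/set0P[a0 Aa0]] := eqVneq A set0.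
  have [k0|/set0P/(@cardinal_wf k)[x _ xmin]] := eqVneq [set: k] set0.
    by left; rewrite k0; exact: card_ge0.
  right; exists x; rewrite card_eq0; apply/eqP; rewrite -subset0 => y /= yx.
  by have := xmin y I; rewrite leNgt yx.
pose F (x : k) (rec : forall y, (y < x)%O -> T) : T :=
  xget a0 [set t | A t /\ forall y (yx : (y < x)%O), rec y yx <> t].
pose f := Fix (@cardinal_lt_wf k) (fun=> T) F.
have fE (x : k) : f x =
    xget a0 [set t | A t /\ forall y : k, (y < x)%O -> f y <> t].
  rewrite /f Fix_eq // => {}x g h gh; congr xget.
  apply/seteqP; split => t /= [At gt];
  by split=> // y yx; rewrite ?gh // -gh.
have AfE (x : k) : A (f x).
  rewrite fE; case: xgetP => [y _ []//|_]; exact: Aa0.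
pose E (x : k) := [set t | A t /\ forall y : k, (y < x)%O -> f y <> t].
have finj (x y : k) : E y !=set0 -> (x < y)%O -> f x <> f y.
  move=> [t Et] xy; rewrite [f y]fE; case: xgetP => [z _ [_ +]|/(_ t)//].
  exact.
have [[x0 Ex0]|noE] := pselect (exists x, ~ (E x !=set0)); last first.
  have Ex x : E x !=set0 by apply: contrapT => nE; apply: noE; exists x.
  left; apply: (@injective_card_le _ _ _ _ f) => // x y _ _ fxy.
  by case: (ltgtP x y) => // /finj; [move/(_ (Ex _))|move/(_ (Ex _)) => /nesym].
right; have [|x Ex xmin] := @cardinal_wf k [set x | ~ (E x !=set0)].
  by exists x0.
have Elt (y : k) : (y < x)%O -> E y !=set0.
  by move=> yx; apply: contrapT => /xmin; rewrite leNgt yx.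
exists x; rewrite card_eq_le; apply/andP; split.
  apply: (@injective_card_le _ _ _ _ f) => // y z yx zx fyz.
  by case: (ltgtP y z) => // /finj;
    [move/(_ (Elt _ zx))|move/(_ (Elt _ yx)) => /nesym].
apply: card_le_trans (card_image_le f (below x)).
apply: subset_card_le => t At /=; apply: contrapT => nt; apply: Ex; exists t.
by split=> // y yx fy; apply: nt; exists y.
Qed.

(** Embeddability in a cardinal spares an appeal to the well-ordering theorem:
    both sets are compared with initial segments of k. *)
Lemma card_le_total (k : cardinal) T U (A : set T) (B : set U) :
  A #<= [set: k] -> B #<= [set: k] -> A #<= B \/ B #<= A.
Proof.
move=> Ak Bk; have [kA|[x xA]] := @card_segment k _ A.
  by right; apply: card_le_trans kA.
have [kB|[y yB]] := @card_segment k _ B; first by left; apply: card_le_trans kB.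
move: xA; rewrite card_eq_le => /andP[xA Ax].
move: yB; rewrite card_eq_le => /andP[yB By].
wlog xy : T U A B x y Ak Bk xA Ax yB By / (x <= y)%O => [H|].
  have [/H|/ltW/H] := leP x y; first by apply; eassumption.
  by move=> /(_ U T B A) []; auto.
left; apply: (card_le_trans Ax); apply: card_le_trans yB.
by apply: subset_card_le => z /= zx; exact: lt_le_trans xy.
Qed.

(** * Squares of infinite sets *)

(** A pair (B, f) stands for an injection of B x B into B; keeping f
    total avoids a type of functions that depends on B. *)
Definition extends_square T (p q : set T * (T * T -> T)) :=
  p.1 `<=` q.1 /\ forall x y, p.1 x -> p.1 y -> p.2 (x, y) = q.2 (x, y).

Definition square_injection T (A : set T) (p : set T * (T * T -> T)) :=
  [/\ p.1 `<=` A, infinite_set p.1,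
      forall x y, p.1 x -> p.1 y -> p.1 (p.2 (x, y)) &
      forall x y z t, p.1 x -> p.1 y -> p.1 z -> p.1 t ->
        p.2 (x, y) = p.2 (z, t) -> x = z /\ y = t].

Lemma square_injection_countable T (A : set T) : infinite_set A ->
  exists p, square_injection A p.
Proof.
move=> /infiniteP An; have [|e [Ae einj]] := card_le_inj An; first by exists 0%N.
have eI x y : e x = e y -> x = y by exact: einj.
have [g gE] : exists g : T -> nat, forall n, g (e n) = n.
  have /choice[g gE] : forall t, exists n, (exists m, e m = t) -> e n = t.
    move=> t; have [[n <-]|nt] := pselect (exists m, e m = t); first by exists n.
    by exists 0%N => /nt.
  by exists g => n; apply: eI; apply: gE; exists n.
exists (range e, fun xy => e (pickle (g xy.1, g xy.2))); split => /=.
- by move=> _ [n _ <-]; exact: Ae.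
- apply/infiniteP; apply: (@injective_card_le _ _ _ _ e) => //.
- by move=> x y _ _; exists (pickle (g x, g y)).
- move=> _ _ _ _ [x _ <-] [y _ <-] [z _ <-] [t _ <-]; rewrite !gE => /eI.
  by move=> /(pcan_inj pickleK)[-> ->].
Qed.

Lemma square_injection_chain T (A : set T)
    (Q : set {p : set T * (T * T -> T) | square_injection A p}) :
  Q !=set0 ->
  (forall p q, Q p -> Q q ->
     extends_square (sval p) (sval q) \/ extends_square (sval q) (sval p)) ->
  exists r, square_injection A r /\ forall p, Q p -> extends_square (sval p) r.
Proof.
move=> [p0 Qp0] tot.
pose B := [set x | exists2 p, Q p & (sval p).1 x].
have both x y : B x -> B y -> exists p, [/\ Q p, (sval p).1 x & (sval p).1 y].
  move=> [p Qp px] [q Qq qy]; have [[pq _]|[qp _]] := tot _ _ Qp Qq.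
    by exists q; split => //; exact: pq.
  by exists p; split => //; exact: qp.
have /choice[f fE] : forall xy : T * T, exists z, B xy.1 -> B xy.2 ->
    exists p, [/\ Q p, (sval p).1 xy.1, (sval p).1 xy.2 & z = (sval p).2 xy].
  move=> [x y] /=; have [[Bx By]|nB] := pselect (B x /\ B y); last first.
    by exists x => Bx By; case: nB.
  have [p [Qp px py]] := both _ _ Bx By.
  by exists ((sval p).2 (x, y)) => _ _; exists p.
have fp p x y : Q p -> (sval p).1 x -> (sval p).1 y ->
    f (x, y) = (sval p).2 (x, y).
  move=> Qp px py.
  have [|/=|/= q [Qq qx qy ->]] := fE (x, y); [by exists p|by exists p|].
  by have [[_ ->]|[_ ->]] := tot _ _ Qp Qq.
exists (B, f); split; last first.
  move=> p Qp; split => /=; first by move=> x px; exists p.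
  by move=> x y px py; rewrite (fp p).
split => /=.
- by move=> x [[p [pA ? ? ?]] Qp] /=; exact: pA.
- have [_ i0 _ _] := svalP p0.
  by apply: sub_infinite_set i0 => x px; exists p0.
- move=> x y Bx By; have [p [Qp px py]] := both _ _ Bx By.
  by rewrite (fp p) //; exists p => //; have [_ _ + _] := svalP p; apply.
- move=> x y z t Bx By Bz Bt.
  have [p [Qp px py]] := both _ _ Bx By; have [q [Qq qz qt]] := both _ _ Bz Bt.
  rewrite (fp p) // (fp q) //; have [_ _ _ pI] := svalP p; have [_ _ _ qI] := svalP q.
  have [[pq E]|[qp E]] := tot _ _ Qp Qq.
    by rewrite E //; apply: qI => //; exact: pq.
  by rewrite E //; apply: pI => //; exact: qp.
Qed.

(** If a disjoint copy g(B) of B fits in A, then the square of the union of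
    B and g(B) exceeds B x B by three blocks, each in bijection with B x B.
    With a different tag in B for each block, f(tag, f(u, v)) sends the three
    blocks injectively into B, and g then moves them into g(B). *)
Lemma square_injection_grow T (A : set T) p : square_injection A p ->
  p.1 #<= A `\` p.1 ->
  exists q, [/\ square_injection A q, extends_square p q & ~ (q.1 `<=` p.1)].
Proof.
case: p => B f [/= BA Binf fB finj] BD.
have [b0 Bb0] := infinite_setN0 Binf.
have [|g [gA gI]] := card_le_inj BD; first by exists b0.
move/infiniteP: (Binf) => nB.
have [|e [eB eI]] := card_le_inj nB; first by exists 0%N.
pose B' := B `|` g @` B.
have Bg x y : B x -> B y -> x <> g y by move=> Bx By E; have [_] := gA _ By; rewrite -E.
have /choice[u uE] : forall z, exists x, B' z -> B x /\ (z = x \/ z = g x).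
  move=> z; have [[Bz|[x Bx <-]]|nz] := pselect (B' z).
  - by exists z => _; split => //; left.
  - by exists x => _; split => //; right.
  - by exists z.
(* c x y tells apart the four cases of membership of x and y in B. *)
pose c x y : T := e (pickle (`[<B x>], `[<B y>])).
have cB x y : B (c x y) by exact: eB.
pose f' xy := if `[<B xy.1>] && `[<B xy.2>] then f xy
  else g (f (c xy.1 xy.2, f (u xy.1, u xy.2))).
have uB x : B' x -> B (u x) by move=> /uE[].
have uI x y : B' x -> B' y -> `[<B x>] = `[<B y>] -> u x = u y -> x = y.
  move=> B'x B'y xy uxy.
  have [Bux [Ex|Ex]] := uE _ B'x; have [Buy [Ey|Ey]] := uE _ B'y.
  - by rewrite Ex Ey.
  - have : `[<B y>] by rewrite -xy; apply/asboolP; rewrite Ex.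
    by move=> /asboolP By; case: (Bg _ _ By Buy).
  - have : `[<B x>] by rewrite xy; apply/asboolP; rewrite Ey.
    by move=> /asboolP Bx; case: (Bg _ _ Bx Bux).
  - by rewrite Ex Ey uxy.
have f'in x y : B x -> B y -> f' (x, y) = f (x, y).
  by move=> Bx By; rewrite /f' /= !asboolT.
have f'out x y : B' x -> B' y -> ~ (B x /\ B y) ->
    f' (x, y) = g (f (c x y, f (u x, u y))).
  move=> _ _ nB2; rewrite /f' /=.
  by case: ifP => // /andP[/asboolP ? /asboolP ?]; case: nB2.
exists (B', f'); split.
- split => /=.
  + by move=> x [/BA//|[y By <-]]; have [] := gA _ By.
  + by apply: sub_infinite_set Binf => x Bx; left.
  + move=> x y B'x B'y; have [[Bx By]|nB2] := pselect (B x /\ B y).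
      by rewrite f'in //; left; exact: fB.
    rewrite f'out //; right; exists (f (c x y, f (u x, u y))) => //.
    by apply: (fB) => //; apply: (fB); exact: uB.
  + move=> x y z t B'x B'y B'z B't.
    have Bff a b : B' a -> B' b -> B (f (c a b, f (u a, u b))).
      by move=> ? ?; apply: (fB) => //; apply: (fB); exact: uB.
    have Bf a b : B' a -> B' b -> B (f (u a, u b)).
      by move=> ? ?; apply: fB; exact: uB.
    have pI' a b a' b' : B' a -> B' b -> B' a' -> B' b' ->
        f (u a, u b) = f (u a', u b') -> u a = u a' /\ u b = u b'.
      by move=> ? ? ? ?; apply: finj; exact: uB.
    have [[Bx By]|nxy] := pselect (B x /\ B y);
      have [[Bz Bt]|nzt] := pselect (B z /\ B t).
    * by rewrite !f'in //; exact: finj.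
    * by rewrite f'in // f'out // => /Bg; case; [exact: fB|exact: Bff].
    * by rewrite f'out // f'in // => /esym/Bg; case; [exact: fB|exact: Bff].
    * rewrite !f'out // => E.
      have {}E := gI _ _ (Bff _ _ B'x B'y) (Bff _ _ B'z B't) E.
      have [{}E /pI'[//|//|//|//|ux uy]] := finj _ _ _ _
        (cB x y) (Bf _ _ B'x B'y) (cB z t) (Bf _ _ B'z B't) E.
      have /(pcan_inj pickleK)[bx by_] := eI _ _ I I E.
      by split; apply: uI.
- split => /=; first by move=> x Bx; left.
  by move=> x y Bx By; rewrite f'in.
- move=> /= /(_ (g b0)) H; have : B (g b0) by apply: H; right; exists b0.
  by have [] := gA _ Bb0.
Qed.

(** Hessenberg's theorem, by Zorn's lemma: if (B, f) is maximal and A does not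
    embed in B, then B embeds in the complement of B in A, which contradicts
    [square_injection_grow]. *)
Lemma card_square (k : cardinal) T (A : set T) : A #<= [set: k] ->
  infinite_set A -> A `*` A #<= A.
Proof.
move=> Ak Ainf; have [p0 p0s] := square_injection_countable Ainf.
have [|||[p ps] pmax] := @ZL_preorder {p | square_injection A p}
  (exist _ p0 p0s) (fun p q => `[<extends_square (sval p) (sval q)>]).
- by move=> p; apply/asboolP; split.
- move=> [p ?] [q ?] [r ?] /= /asboolP[pq pqE] /asboolP[qr qrE]; apply/asboolP; split.
    exact: subset_trans qr.
  by move=> x y px py; rewrite pqE // qrE //; exact: pq.
- move=> Q tot; have [->|/set0P Q0] := eqVneq Q set0; first by exists (exist _ p0 p0s).
  have [|r [rs rE]] := @square_injection_chain _ _ Q Q0.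
    move=> p q Qp Qq.
    by have [/asboolP|/asboolP] := tot _ _ Qp Qq; [left|right].
  by exists (exist _ r rs) => p Qp; apply/asboolP; exact: rE.
have [pA pinf pp pI] := ps.
have pk : p.1 #<= [set: k] by apply: card_le_trans Ak; exact: subset_card_le.
have pplep : p.1 `*` p.1 #<= p.1.
  apply: (@injective_card_le _ _ _ _ p.2); first by move=> [x y] [/= px py]; exact: pp.
  by move=> [x y] [z t] [/= px py] [/= pz pt] /pI[] // -> ->.
suff Ap : A #<= p.1.
  have pA' : p.1 #<= A by exact: subset_card_le.
  apply: card_le_trans pA'; apply: card_le_trans pplep.
  have [a0 Aa0] := infinite_setN0 Ainf.
  have [|f [fp fI]] := card_le_inj Ap; first by exists a0.
  apply: (@injective_card_le _ _ _ _ (fun xy => (f xy.1, f xy.2))).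
    by move=> [x y] [/= Ax Ay]; split; exact: fp.
  by move=> [x y] [z t] [/= Ax Ay] [/= Az At] [/fI -> // /fI ->].
have Dk : A `\` p.1 #<= [set: k] by apply: card_le_trans Ak; exact: card_le_setD.
have [Dp|pD] := card_le_total Dk pk; last first.
  have [q [qs pq nqp]] := square_injection_grow ps pD.
  have /asboolP[//] := pmax (exist _ q qs) (asboolT pq).
apply: card_le_trans pplep.
move/infiniteP: (pinf) => np.
have [|e [ep eI]] := card_le_inj np; first by exists 0%N.
have [D0|/set0P D0] := eqVneq (A `\` p.1) set0.
  have Ap : A `<=` p.1.
    by move=> x Ax; apply: contrapT => npx; have : (A `\` p.1) x by []; rewrite D0.
  apply: (@injective_card_le _ _ _ _ (fun x => (x, x))) => [x Ax|x y _ _ [] //].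
  by split; exact: Ap.
have [g [gp gI]] := card_le_inj Dp D0.
apply: (@injective_card_le _ _ _ _
  (fun x => if `[<p.1 x>] then (e 0%N, x) else (e 1%N, g x))).
  move=> x Ax; case: asboolP => px; split => //=; try exact: ep.
  exact: gp.
move=> x y Ax Ay; case: asboolP => px; case: asboolP => py [].
- by [].
- by move/eI => /(_ I I).
- by move/eI => /(_ I I).
- by move=> /gI; apply.
Qed.

Lemma card_le_bigcup (k : cardinal) T U S (A : set U) (I : set S)
    (F : S -> set T) : A #<= [set: k] -> infinite_set A -> I #<= A ->
  (forall i, I i -> F i #<= A) -> \bigcup_(i in I) F i #<= A.
Proof.
move=> Ak Ainf IA FA; apply: card_le_trans (card_square Ak Ainf).
have [->|/set0P[x0 [i0 Ii0 Fx0]]] := eqVneq (\bigcup_(i in I) F i) set0.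
  exact: card_ge0.
have [|h [hA hI]] := card_le_inj IA; first by exists i0.
have [a0 Aa0] := infinite_setN0 Ainf.
have /choice[g gE] : forall i, exists g : T -> U, I i ->
    (forall x, F i x -> A (g x)) /\
    (forall x y, F i x -> F i y -> g x = g y -> x = y).
  move=> i; have [[Ii /(card_le_inj (FA i Ii))[g gE]]|nI] :=
      pselect (I i /\ F i !=set0); first by exists g.
  exists (fun=> a0) => Ii; split=> // x y Fx; case: nI; split => //; by exists x.
have /choice[j jE] : forall x, exists i, (\bigcup_(i in I) F i) x -> I i /\ F i x.
  move=> x; have [[i Ii Fx]|nx] := pselect ((\bigcup_(i in I) F i) x).
    by exists i.
  by exists i0 => /nx.
apply: (@injective_card_le _ _ _ _ (fun x => (h (j x), g (j x) x))).
  move=> x /jE[Ij Fj]; split => /=; first exact: hA.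
  by have [+ _] := gE _ Ij; apply.
move=> x y /jE[Ijx Fjx] /jE[Ijy Fjy] [hxy gxy].
have jxy := hI _ _ Ijx Ijy hxy; rewrite jxy in Fjx gxy.
by have [_ gI] := gE _ Ijy; exact: gI.
Qed.

Lemma cardinal_no_max (k : cardinal) : infinite_cardinal k ->
  forall x : k, exists y, (x < y)%O.
Proof.
move=> kinf x; apply: contrapT => nx.
have le_x y : (y <= x)%O by rewrite leNgt; apply/negP => xy; apply: nx; exists y.
have xE : [set: k] = \bigcup_(b in [set: bool]) (if b then below x else [set x]).
  apply/seteqP; split => // y _; have := le_x y; rewrite le_eqVlt => /orP[/eqP ->|yx].
    by exists false.
  by exists true.
have xinf : infinite_set (below x).
  move=> xfin; apply: kinf; rewrite xE; apply: bigcup_finite => // -[] _ //.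
have fin_le S (B : set S) : finite_set B -> B #<= below x.
  move=> /finite_setP[n]; rewrite card_eq_le => /andP[Bn _].
  apply: card_le_trans Bn _; apply: card_le_trans (subset_card_le (@subsetT _ _)) _.
  exact/infiniteP.
apply: (@cardinal_initial k x); rewrite [X in X #<= _]xE.
apply: (@card_le_bigcup k) => //; first exact: subset_card_le.
  exact: fin_le.
by move=> [] _; [exact: card_lexx|exact: fin_le].
Qed.

(** * Ideals additive over an index set *)

Section Additive.
Variables (V : Type) (small : set (set V)).

(** Additivity of [small] over the set A. Its contrapositive, [not_small_fiber],
    says that if a set that is not small is covered by pieces indexed by
    A, then some piece is not small. *)
Definition additive_over T (A : set T) := forall F : T -> set V,
  (forall t, A t -> small (F t)) -> small (\bigcup_(t in A) F t).

Hypothesis small_sub : forall B C, B `<=` C -> small C -> small B.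
Hypothesis small0 : small set0.

Lemma additive_image S T (h : S -> T) (A : set S) :
  additive_over A -> additive_over (h @` A).
Proof.
move=> addA F sF; rewrite bigcup_image; apply: addA => s As; apply: sF.
by exists s.
Qed.

Lemma additive_fibers S T (g : S -> T) (A : set S) (B : set T) :
  additive_over B -> (forall s, A s -> B (g s)) ->
  (forall t, B t -> additive_over (A `&` g @^-1` [set t])) -> additive_over A.
Proof.
move=> addB gB addA F sF.
apply: (@small_sub _ (\bigcup_(t in B) \bigcup_(s in A `&` g @^-1` [set t]) F s)).
  by move=> v [s As Fv]; exists (g s); [exact: gB|exists s].
by apply: addB => t Bt; apply: addA => // s [As _]; exact: sF.
Qed.

Lemma additive_sub T (A B : set T) : A `<=` B -> additive_over B -> additive_over A.
Proof.
move=> AB addB F sF.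
apply: (@small_sub _ (\bigcup_(t in B) [set v | A t /\ F t v])).
  by move=> v [s As Fv]; exists s => //; exact: AB.
apply: addB => t Bt; have [At|nAt] := pselect (A t).
  by apply: small_sub (sF _ At) => v [].
by apply: small_sub small0 => v [].
Qed.

Lemma additive_card_le S T (A : set S) (B : set T) :
  A #<= B -> additive_over B -> additive_over A.
Proof.
have [-> _ _|/set0P[s0 As0]] := eqVneq A set0.
  by move=> F _; rewrite bigcup_set0.
move=> /card_le_inj[]; first by exists s0.
move=> f [fB fI] addB.
have /choice[g gE] : forall t, exists s,
    (exists2 s', A s' & f s' = t) -> A s /\ f s = t.
  move=> t; have [[s As fs]|nt] := pselect (exists2 s', A s' & f s' = t).
    by exists s.
  by exists s0 => /nt.
apply: (@additive_sub _ _ (g @` (f @` A))).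
  move=> s As; exists (f s); first by exists s.
  by have [|+ +] := gE (f s); [exists s|move=> ? /fI ->].
apply: additive_image; apply: additive_sub addB => _ [s As <-]; exact: fB.
Qed.

Lemma additive_setX S T (A : set S) (B : set T) :
  additive_over A -> additive_over B -> additive_over (A `*` B).
Proof.
move=> addA addB; apply: (additive_fibers addA (g := fst)); first by move=> [s t] [].
move=> s As; apply: (@additive_sub _ _ ((fun t => (s, t)) @` B)).
  by move=> [s' t] [[/= As' Bt] ->]; exists t.
exact: additive_image.
Qed.

Hypothesis additive_nat : additive_over [set: nat].

Lemma additive_countable (T : countType) (A : set T) : additive_over A.
Proof. by apply: additive_card_le additive_nat; exact: countableP. Qed.

Lemma additive_seq (T : eqType) (A : set T) :
  additive_over A -> additive_over [set s : seq T | forall x, x \in s -> A x].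
Proof.
move=> addA; apply: (additive_fibers additive_nat (g := size)) => // n _.
elim: n => [|n IHn].
  apply: additive_sub (@additive_image nat _ (fun=> [::]) _ additive_nat).
  by move=> s [_ /size0nil ->]; exists 0%N.
have := @additive_image _ _ (fun xs : T * seq T => xs.1 :: xs.2) _
  (additive_setX addA IHn).
apply: additive_sub => -[[_ //]|x s] [Axs [ss]]; exists (x, s) => //; split => /=.
  by apply: Axs; rewrite mem_head.
by split=> // y ys; apply: Axs; rewrite in_cons ys orbT.
Qed.

Lemma not_small_fiber T (A : set T) (B : set V) (r : V -> T -> Prop) :
  additive_over A -> ~ small B -> (forall v, B v -> exists2 t, A t & r v t) ->
  exists2 t, A t & ~ small [set v | B v /\ r v t].
Proof.
move=> addA nB Br; apply: contrapT => nt; apply: nB.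
apply: small_sub (addA (fun t => [set v | B v /\ r v t]) _).
  by move=> v Bv; have [t At rt] := Br _ Bv; exists t.
by move=> t At; apply: contrapT => ns; apply: nt; exists t.
Qed.

End Additive.

(** * Non-cofinal sets and sets of bounded cardinality *)

Section Ideals.
Variable k : cardinal.

Lemma not_cofinalP (A : set k) :
  ~ cofinal A <-> exists x, forall y, A y -> (y < x)%O.
Proof.
split=> [/existsNP[x nx]|[x Ax] /(_ x)[y /Ax]]; last by rewrite ltNge => /negP.
by exists x => y Ay; rewrite ltNge; apply/negP => xy; apply: nx; exists y.
Qed.

Lemma not_cofinal_sub (A B : set k) : A `<=` B -> ~ cofinal B -> ~ cofinal A.
Proof.
move=> AB /not_cofinalP[x Bx]; apply/not_cofinalP; exists x => y /AB; exact: Bx.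
Qed.

Lemma not_cofinal0 (C : set k) T (A : set T) : is_cofinality C ->
  ~ (C #<= A) -> ~ cofinal (set0 : set k).
Proof.
by move=> [_ Cmin] nCA /Cmin C0; apply: nCA; apply: (card_le_trans C0).
Qed.

(** Choose a bound for each non-cofinal set F t. By minimality of |C| the bounds
    are not cofinal, and a bound of the bounds bounds the union. *)
Lemma additive_not_cofinal (C : set k) T (A : set T) : is_cofinality C ->
  ~ (C #<= A) -> additive_over [set B : set k | ~ cofinal B] A.
Proof.
move=> [Ccof Cmin] nCA F sF.
have /choice[b bE] : forall t, exists x, A t -> forall y, F t y -> (y < x)%O.
  move=> t; have [At|nAt] := pselect (A t).
    by have /not_cofinalP[x Ax] := sF _ At; exists x.
  have [k0|/set0P[x _]] := eqVneq [set: k] set0; last by exists x.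
  exfalso; apply: nCA; suff -> : C = set0 by exact: card_ge0.
  by rewrite -subset0 -k0.
have /not_cofinalP[x xE] : ~ cofinal (b @` A).
  move=> /Cmin Cb; apply: nCA; apply: (card_le_trans Cb); exact: card_image_le.
apply/not_cofinalP; exists x => y [t At Fy].
by apply: (lt_trans (bE _ At _ Fy)); apply: xE; exists t.
Qed.

Lemma additive_card_below (c : k) T (A : set T) : infinite_set (below c) ->
  A #<= below c -> additive_over [set B : set k | B #<= below c] A.
Proof.
by move=> cinf Ac F; apply: (@card_le_bigcup k) => //; exact: subset_card_le.
Qed.

(** A bounded subset of C may still be as large as C. Well-order C in its least
    order type through r, and keep only the records: the elements that exceed
    all the elements enumerated before them. The records below a given record c
    are enumerated before c, so they are fewer than |C|. *)
Lemma cofinality_records (C : set k) : is_cofinality C ->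
  exists2 C' : set k, cofinal C' &
    forall D, D `<=` C' -> ~ cofinal D -> ~ (C #<= D).
Proof.
move=> [Ccof Cmin].
have [r [rI rC]] : exists r : k -> k,
    (forall x y, C x -> C y -> r x = r y -> x = y) /\
    (forall x, C x -> ~ (C #<= below (r x))).
  have [[m0 m0C]|nm] := pselect (exists m : k, C #<= below m); last first.
    by exists id; split=> // x Cx Cr; apply: nm; exists x.
  have [|m Cm mmin] := @cardinal_wf k [set m | C #<= below m]; first by exists m0.
  have [x0 [y0 Cy0 _]] : exists x0 : k, exists2 y, C y & (x0 <= y)%O.
    by exists m0; exact: Ccof.
  have [|r [rm rI]] := card_le_inj Cm; first by exists y0.
  exists r; split=> // x /rm /= rxm Cr.
  by have := mmin _ Cr; rewrite leNgt rxm.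
pose C' := [set c | C c /\ forall d, C d -> (r d < r c)%O -> (d < c)%O].
(* The first element of C enumerated at or above x is a record. *)
have C'cof : cofinal C'.
  move=> x; have [y0 Cy0 xy0] := Ccof x.
  have [|_ [c [Cc xc] <-] cmin] :=
    @cardinal_wf k (r @` [set c | C c /\ (x <= c)%O]).
    by exists (r y0); exists y0.
  exists c => //; split => // d Cd dc.
  rewrite (lt_le_trans _ xc) // ltNge; apply/negP => xd.
  have : (r c <= r d)%O by apply: cmin; exists d.
  by rewrite leNgt dc.
exists C' => // D DC' /not_cofinalP[x Dx] CD.
have [c [Cc cC'] xc] := C'cof x.
apply: (rC _ Cc); apply: (card_le_trans CD).
apply: (@injective_card_le _ _ _ _ r) => [d Dd|d e]; last first.
  by move=> /DC'[Cd _] /DC'[Ce _]; exact: rI.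
have [Cd dC'] := DC' _ Dd; have dc : (d < c)%O := lt_le_trans (Dx _ Dd) xc.
rewrite /below /=; case: (ltgtP (r d) (r c)) => // [/(dC' _ Cc)|/rI E].
  by rewrite ltNge (ltW dc).
by move: dc; rewrite E // ltxx.
Qed.

End Ideals.

(** * Delta-systems *)

(** Take a maximal subfamily D with pairwise disjoint S i. If D is cofinal, it
    is the required family. Otherwise D is smaller than C, every S i outside D
    meets one of the few finite sets in D, and so by the pigeonhole principle
    cofinally many of the S i share an element t; removing t shortens the
    sequences, and induction applies. *)
Lemma delta_system (k : cardinal) (C C' : set k) (T : eqType)
    (S : k -> seq T) (n : nat) (B : set k) :
  is_cofinality C -> ~ (C #<= [set: nat]) ->
  (forall D, D `<=` C' -> ~ cofinal D -> ~ (C #<= D)) ->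
  B `<=` C' -> cofinal B -> (forall i, B i -> (size (S i) <= n)%N) ->
  exists D (R : seq T), [/\ D `<=` B, cofinal D &
    forall i j a, D i -> D j -> i <> j -> a \in S i -> a \in S j -> a \in R].
Proof.
move=> cofC uncC smallC'; elim: n S B => [|n IHn] S B BC' Bcof Sn.
  exists B, [::]; split => // i j a Bi _ _.
  by have := Sn _ Bi; rewrite leqn0 => /nilP ->.
have [D [DB triD Dmax]] := ex_maximal_disjoint_subcollection
  (fun i => [set a | a \in S i]) B.
have [Dcof|Dncof] := pselect (cofinal D).
  exists D, [::]; split=> // i j a Di Dj ij ai aj; exfalso; apply: ij.
  by apply: triD => //; exists a.
have subN := @not_cofinal_sub k.
have N0 := not_cofinal0 cofC uncC.
have addN := additive_not_cofinal cofC uncC.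
have addD : additive_over [set E : set k | ~ cofinal E] (D `*` [set: nat]).
  apply: additive_setX => //; apply: (additive_not_cofinal cofC).
  by apply: smallC' => //; exact: subset_trans BC'.
have [x0 Dx0] := (not_cofinalP D).1 Dncof.
have BDcof : cofinal (B `\` D).
  move=> x; have [y By xy] := Bcof (Order.max x x0).
  move: xy; rewrite ge_max => /andP[xy x0y]; exists y => //; split => // /Dx0.
  by rewrite ltNge x0y.
(* The element shared with S j is recorded by its position in S j, so that the
   pairs lie in the product of D with nat, over which additivity holds. *)
have meets i : (B `\` D) i -> exists2 jm, (D `*` [set: nat]) jm &
    exists2 a, onth (S jm.1) jm.2 = Some a & a \in S i.
  move=> [Bi nDi]; apply: contrapT => nm.
  have disj j a : D j -> a \in S i -> a \in S j -> False.
    move=> Dj ai aj; apply: nm; exists (j, index a (S j)) => //; exists a => //=.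
    by rewrite onthE (nth_map a) ?index_mem // nth_index.
  apply: (Dmax (D `|` [set i])).
  - split=> [|/(_ i)]; first by move=> j; left.
    by move=> Di; apply: nDi; apply: Di; right.
  - by move=> j [/DB //|->].
  - move=> j l [Dj|->] [Dl|->] [a [/= aj al]] //.
    - by apply: triD => //; exists a.
    - by case: (disj j a).
    - by case: (disj l a).
have [|[j m] _ /contrapT] := not_small_fiber subN addD _ meets; first exact.
set D' := [set i | _] => D'cof.
have [i0 [_ [t St _]] _] := D'cof x0.
have D't i : D' i -> t \in S i by move=> [_ [a]]; rewrite St => -[->].
have [||E [R [ED' Ecof ER]]] := IHn (fun i => rem t (S i)) D' _ D'cof.
- by move=> i [[/BC']].
- by move=> i D'i; rewrite size_rem ?D't //; have := Sn i D'i.1.1; case: size.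
exists E, (t :: R); split => //; first by move=> i /ED' [[]].
move=> i l a Ei El il; rewrite !(perm_mem (perm_to_rem (D't _ (ED' _ Ei)))).
rewrite (perm_mem (perm_to_rem (D't _ (ED' _ El)))) !in_cons.
have [//|_ /=] := eqVneq a t; exact: ER.
Qed.

(** * Basic open sets of function spaces *)

Local Open Scope ring_scope.

Section Boxes.
Variables (R : realType) (Y : topologicalType).

Definition in_box (l : seq (Y * (rat * rat))) (f : Y -> R) : Prop :=
  forall e, e \in l -> ratr e.2.1 < f e.1 < ratr e.2.2.

Definition Cp_fun (f : Cp R Y) : Y -> R := set_val f.

Lemma Cp_fun_continuous (f : Cp R Y) : continuous (Cp_fun f).
Proof. by have /set_mem := valP f. Qed.

Lemma Cp_of (f : Y -> R) : continuous f -> exists g : Cp R Y, Cp_fun g = f.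
Proof.
by move=> cf; exists (@SigSub _ _ [set f : {ptws Y -> R} | continuous (f : Y -> R)]
  (f : {ptws Y -> R}) (mem_set cf)).
Qed.

Lemma Cp_eval_continuous (y : Y) : continuous (fun f : Cp R Y => Cp_fun f y).
Proof.
move=> f; apply: (@continuous_comp _ {ptws Y -> R} R set_val (fun g => g y)).
  exact: initial_continuous.
have := (@pointwise_cvgP Y R (nbhs (set_val f : {ptws Y -> R})) (set_val f) _).1.
by apply.
Qed.

Lemma open_in_box l : open [set f : Cp R Y | in_box l (Cp_fun f)].
Proof.
elim: l => [|[y [a b]] l IHl].
  rewrite (_ : [set f | _] = setT); first exact: openT.
  by apply/seteqP; split.
rewrite (_ : [set f | _] = (fun f : Cp R Y => Cp_fun f y) @^-1` `]ratr a, ratr b[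
   `&` [set f : Cp R Y | in_box l (Cp_fun f)]); last first.
  apply/seteqP; split => [f fl|f [fab fl] e].
    split; last by move=> e el; apply: fl; rewrite in_cons el orbT.
    by rewrite /= in_itv /=; apply: (fl (y, (a, b))); rewrite mem_head.
  rewrite in_cons => /orP[/eqP ->|/fl //] /=; by move: fab; rewrite /= in_itv.
apply: openI => //; apply: open_comp; last exact: interval_open.
by move=> f _; exact: Cp_eval_continuous.
Qed.

(** The boxes containing f generate a filter that converges to f pointwise. *)
Lemma in_box_nbhs (U : set (Cp R Y)) (f : Cp R Y) : open U -> U f ->
  exists l, in_box l (Cp_fun f) /\ forall g, in_box l (Cp_fun g) -> U g.
Proof.
move=> [V oV <-] Vf.
pose F := filter_from [set l | in_box l (Cp_fun f)]
  (fun l => [set g : {ptws Y -> R} | in_box l g]).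
have FF : Filter F.
  apply: filter_from_filter; first by exists [::].
  move=> l l' fl fl'; exists (l ++ l').
    by move=> e; rewrite mem_cat => /orP[/fl|/fl'].
  move=> g gl; split => e el; apply: gl; by rewrite mem_cat el ?orbT.
have : {ptws, F --> (Cp_fun f)}.
  apply/pointwise_cvgP => y W /nbhs_ballP[e /= e0 eW].
  have [|a] := @rat_in_itvoo R (Cp_fun f y - e) (Cp_fun f y).
    by rewrite ltrBlDr ltrDl.
  rewrite in_itv /= => /andP[ea af].
  have [|b] := @rat_in_itvoo R (Cp_fun f y) (Cp_fun f y + e).
    by rewrite ltrDl.
  rewrite in_itv /= => /andP[fb be].
  exists [:: (y, (a, b))]; first by move=> _ /[!inE] /eqP -> /=; rewrite af fb.
  move=> g /(_ _ (mem_head _ _)) /= /andP[ag gb]; apply: eW => /=.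
  rewrite /ball /= ltr_norml; apply/andP; split; lra.
move=> /(_ V)[]; first by apply: open_nbhs_nbhs.
by move=> l fl lV; exists l; split => // g /lV.
Qed.

End Boxes.

(** * Functions on a topological sum *)

Lemma continuous_summands (I : choiceType) (X : I -> topologicalType)
    (Z : topologicalType) (f : {a & X a} -> Z) :
  (forall a, continuous (fun x => f (existT X a x))) -> continuous f.
Proof. by move=> cf [a x] U Uf; apply: existT_continuous; exact: cf. Qed.

(** The delta-system lemma is applied to the summands met by the constraint
    lists. Disjointness of supports has to be sought at the level of summands,
    not of points, because continuity has to be preserved by the gluing. *)
Lemma cofinal_common_function (R : realType) (k : cardinal) (C : set k)
    (I : choiceType) (X : I -> topologicalType)
    (l : k -> seq ({a & X a} * (rat * rat))) (f : k -> {a & X a} -> R) :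
  is_cofinality C -> ~ (C #<= [set: nat]) -> (forall a, ~ (C #<= [set: X a])) ->
  (forall i, continuous (f i)) -> (forall i, in_box (l i) (f i)) ->
  exists D (h : {a & X a} -> R),
    [/\ cofinal D, continuous h & forall i, D i -> in_box (l i) h].
Proof.
move=> cofC uncC uncX cf fl.
have [C' C'cof smallC'] := cofinality_records cofC.
pose S i := [seq tag e.1 | e <- l i].
have subN := @not_cofinal_sub k.
have N0 := not_cofinal0 cofC uncC.
have addN := additive_not_cofinal cofC uncC.
have [||n _ /contrapT Bcof] := @not_small_fiber _ _ subN _ _ C'
  (fun i n => (size (S i) <= n)%N) addN.
- exact.
- by move=> i _; exists (size (S i)).
have [||D [Q [DB Dcof DQ]]] :=
  delta_system (n := n) (S := S) cofC uncC smallC' _ Bcof.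
- by move=> i [].
- by move=> i [].
have addQ : additive_over [set E : set k | ~ cofinal E]
    [set y : {a & X a} | tag y \in Q].
  apply: (additive_fibers subN (g := tag) (B := [set` Q])).
  - apply: (additive_card_le subN N0 _ addN).
    exact/finite_set_countable/finite_seq.
  - by [].
  - move=> a _; apply: (@additive_sub _ _ subN N0 _ _ (existT X a @` setT)).
      by move=> [b x] [_ /= ba]; subst b; exists x.
    by apply: additive_image; exact: (additive_not_cofinal cofC).
have addE := additive_seq subN N0 addN (additive_setX subN N0 addQ
  (@additive_countable _ _ subN N0 addN _ [set: rat * rat])).
have [||l0 _ /contrapT] := @not_small_fiber _ _ subN _ _ D
  (fun i m => [seq e <- l i | tag e.1 \in Q] = m) addE.
- exact.
- move=> i Di; exists [seq e <- l i | tag e.1 \in Q] => //.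
  by move=> e; rewrite mem_filter => /andP[].
set D2 := [set i | _] => D2cof.
have [i0 [Di0 li0] _] : exists2 i, D2 i & True.
  have [x [y _ _]] : exists x : k, exists2 y, C y & (x <= y)%O.
    apply: contrapT => nC; apply: uncC; suff -> : C = set0 by exact: card_ge0.
    by rewrite -subset0 => x Cx; apply: nC; exists x, x.
  by have [i D2i] := D2cof x; exists i.
have /choice[j jE] : forall a, exists i, (exists2 i', D2 i' & a \in S i') ->
    D2 i /\ a \in S i.
  move=> a; have [[i D2i ai]|na] := pselect (exists2 i', D2 i' & a \in S i').
    by exists i.
  by exists i0 => /na.
pose h y := f (if tag y \in Q then i0 else j (tag y)) y.
exists D2, h; split => //.
  apply: continuous_summands => a x; apply: continuous_comp; last exact: cf.
  exact: existT_continuous.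
move=> i [Di li] -[[a x] pq] el /=; rewrite /h /=.
have [aQ|aQ] := boolP (a \in Q).
  have : (existT X a x, pq) \in [seq e <- l i | tag e.1 \in Q].
    by rewrite mem_filter /= aQ.
  by rewrite li -li0 mem_filter => /andP[_ /fl].
have ai : a \in S i by apply/mapP; exists (existT X a x, pq).
have [|[Dj _] aj] := jE a; first by exists i.
suff -> : j a = i by exact: (fl i (existT X a x, pq)).
by apply: contrapT => ji; move: aQ; rewrite (DQ _ _ a Dj Di ji aj ai).
Qed.

(** * Calibers *)

Lemma calibers_self (Z : topologicalType) (k : cardinal) :
  calibers Z k <-> infinite_cardinal k /\
    forall U : k -> set Z, (forall i, open (U i) /\ U i !=set0) ->
    exists J z, [set: k] #<= J /\ forall i, J i -> U i z.
Proof.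
split=> [[kinf cal]|[kinf cal]]; split=> //.
  move=> U oU; have [J Jk [z Jz]] := cal _ U (card_eqxx _) oU.
  by exists J, z; split=> //; rewrite (card_eq_le J) in Jk; case/andP: Jk.
move=> I U Ik oU; have [x0 _] := infinite_setN0 kinf.
move: Ik; rewrite card_eq_sym => kI.
have [i0 Ii0] : exists i : I, True.
  move: kI; rewrite card_eq_le => /andP[+ _] => /card_le_inj[].
    by exists x0.
  by move=> f _; exists (f x0).
have [phi [_ phiI]] : exists phi : k -> I, (forall x, setT x -> [set: I] (phi x)) /\
    (forall x y, setT x -> setT y -> phi x = phi y -> x = y).
  by move: kI; rewrite card_eq_le => /andP[+ _] => /card_le_inj; apply; exists x0.
have [J [z [kJ Jz]]] := cal (U \o phi) (fun x => oU (phi x)).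
exists (phi @` J); last by exists z => _ [x Jx <-]; exact: Jz.
apply: (@card_eq_trans _ _ _ _ J).
  by apply: inj_card_eq => x y _ _; exact: phiI.
by rewrite card_eq_le kJ andbT card_leT.
Qed.

(** A function on X a extends by zero to the sum, and restriction to X a is
    continuous, so families of nonempty open sets pull back to such families. *)
Lemma calibers_restriction (R : realType) (I : choiceType)
    (X : I -> topologicalType) (a : I) (k : cardinal) :
  calibers (Cp R {a & X a}) k -> calibers (Cp R (X a)) k.
Proof.
move=> /calibers_self[kinf cal]; apply/calibers_self; split => // U oU.
pose V i := [set f : Cp R {a & X a} | exists2 g, U i g &
  forall x, Cp_fun f (existT X a x) = Cp_fun g x].
have [|J [f [kJ Jf]]] := cal V.
  move=> i; have [oUi [g Ug]] := oU i; split.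
    rewrite openE => f [g' Ug' fg'].
    have [l [gl lU]] := in_box_nbhs oUi Ug'.
    pose l' := [seq (existT X a e.1, e.2) | e <- l].
    have lE h : in_box l' h <-> in_box l (fun x => h (existT X a x)).
      split=> hl e; last by move=> /mapP[e' e'l ->] /=; exact: hl.
      move=> el; apply: (hl (existT X a e.1, e.2)); exact: map_f.
    apply: (@filterS _ _ _ [set h : Cp R {a & X a} | in_box l' (Cp_fun h)]); last first.
      apply: open_nbhs_nbhs; split; first exact: open_in_box.
      apply/lE => e /gl; by rewrite fg'.
    move=> h /lE hl.
    have [|h' h'E] := @Cp_of R _ (fun x => Cp_fun h (existT X a x)).
      move=> x; apply: continuous_comp; first exact: existT_continuous.
      exact: Cp_fun_continuous.
    by exists h'; [apply: lU; rewrite h'E|move=> x; rewrite h'E].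
  pose h (y : {a & X a}) : R :=
    if pselect (tag y = a) is left e
    then Cp_fun g (ecast b (X b) e (tagged y)) else 0.
  have [|h' h'E] := @Cp_of R _ h.
    apply: continuous_summands => b; rewrite /h /=.
    case: pselect => [e|_]; last exact: cst_continuous.
    by subst b; exact: Cp_fun_continuous.
  exists h', g => // x; rewrite h'E /h /=; case: pselect => // e.
  by rewrite (Prop_irrelevance e erefl).
have [|g gE] := @Cp_of R _ (fun x => Cp_fun f (existT X a x)).
  move=> x; apply: continuous_comp; first exact: existT_continuous.
  exact: Cp_fun_continuous.
exists J, g; split => // i /Jf[g' Ug' g'E].
suff -> : g = g' by [].
by apply: val_inj; apply/funext => x; rewrite -[LHS]/(Cp_fun g x) gE g'E.
Qed.

(** With C countable, colour each i in k by the number n of an element of C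
    above i, and require f y0 to lie in ]n, n+1[. Indices whose sets have
    a common point have the same colour, so they all lie below one element of
    C and are fewer than k. *)
Lemma uncountable_cofinality (R : realType) (Y : topologicalType) (y0 : Y)
    (k : cardinal) (C : set k) :
  calibers (Cp R Y) k -> is_cofinality C -> ~ (C #<= [set: nat]).
Proof.
move=> /calibers_self[kinf cal] [Ccof _] Cn.
have nomax := cardinal_no_max kinf; have [x0 _] := infinite_setN0 kinf.
have [|e [_ eI]] := card_le_inj Cn.
  by have [y Cy _] := Ccof x0; exists y.
have /choice[c cE] : forall i, exists c, C c /\ (i < c)%O.
  move=> i; have [y iy] := nomax i; have [z Cz yz] := Ccof y.
  by exists z; split => //; exact: lt_le_trans yz.
pose U i := [set f : Cp R Y | (e (c i))%:R < Cp_fun f y0 < (e (c i)).+1%:R].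
have [|J [f [kJ Jf]]] := cal U.
  move=> i; split.
    rewrite (_ : U i = (fun f : Cp R Y => Cp_fun f y0) @^-1`
        `](e (c i))%:R, (e (c i)).+1%:R[).
      apply: open_comp; last exact: interval_open.
      by move=> f _; exact: Cp_eval_continuous.
    by apply/seteqP; split => f; rewrite /= in_itv.
  have [|g gE] := @Cp_of R Y (fun=> (e (c i))%:R + 2^-1).
    exact: cst_continuous.
  by exists g; rewrite /U /= gE -[(e _).+1%:R]natr1; apply/andP; split; lra.
have ecE i j : J i -> J j -> (e (c i) <= e (c j))%N.
  move=> /Jf/andP[ei _] /Jf/andP[_ ej].
  by have := lt_trans ei ej; rewrite ltr_nat ltnS.
have [i0 Ji0] : J !=set0.
  apply/set0P/negP => /eqP J0; rewrite J0 card_le0 in kJ.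
  by move/eqP: kJ => k0; have : [set: k] x0 by []; rewrite k0.
apply: (@cardinal_initial k (c i0)); apply: (card_le_trans kJ).
apply: subset_card_le => i Ji; rewrite /=.
have <- : c i = c i0; last by have [] := cE i.
apply: eI; [by have [] := cE i|by have [] := cE i0|].
by apply/eqP; rewrite eqn_leq !ecE.
Qed.

(** For singular k, let d bound both c and the ordinal m of C. The subsets of k
    of size at most |d| form an ideal additive over sets of size at most |d|.
    The ordinals t a < m of the cardinals |X a| classify the summands, and the
    hypothesis on products bounds each class of nonempty summands by the size
    of one of them, so the ideal is additive over the points of the sum and
    over the constraint lists. *)
Lemma constant_on_large_sets (k : cardinal) (C : set k) (I : choiceType)
    (X : I -> topologicalType) (l : k -> seq ({a & X a} * (rat * rat))) :
  is_cofinality C -> ~ ([set: k] #<= C) -> ~ (C #<= [set: nat]) ->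
  (forall a, [set: X a] #<= C /\ ~ (C #<= [set: X a])) ->
  (forall a, [set: X a] `*` [set b | [set: X b] #= [set: X a]] #<= [set: X a]) ->
  forall c : k, exists i, ~ ([set j | l j = l i] #<= below c).
Proof.
move=> cofC nkC uncC XC Xmult c.
have [//|[m]] := card_segment k C; rewrite card_eq_le => /andP[mC Cm].
pose d := Order.max c m.
have cd : below c `<=` below d.
  by move=> x /= xc; rewrite /below /= lt_max xc.
have md : below m `<=` below d.
  by move=> x /= xm; rewrite /below /= lt_max xm orbT.
have Cd : C #<= below d by apply: (card_le_trans Cm); exact: subset_card_le.
have dinf : infinite_set (below d).
  move=> /finite_set_countable dn; apply: uncC; exact: card_le_trans dn.
pose small : set (set k) := [set B | B #<= below d].
have addd T (A : set T) : A #<= C -> additive_over small A.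
  by move=> AC; apply: additive_card_below => //; exact: card_le_trans Cd.
have sub B B' : B `<=` B' -> small B' -> small B.
  by move=> BB'; apply: card_le_trans; exact: subset_card_le.
have zero : small set0 by exact: card_ge0.
have addN : additive_over small [set: nat].
  by apply: additive_card_below => //; exact/infiniteP.
have /choice[t tE] : forall a, exists t : k, (t < m)%O /\ below t #= [set: X a].
  move=> a; have [XaC nCX] := XC a.
  have [kX|[t tX]] := card_segment k [set: X a].
    by exfalso; apply: nCX; apply: card_le_trans kX; exact: card_leT.
  exists t; split => //; rewrite ltNge; apply/negP => mt; apply: nCX.
  apply: (card_le_trans Cm); move: tX; rewrite card_eq_le => /andP[tX _].
  apply: card_le_trans tX; apply: subset_card_le => x /= xm.
  exact: lt_le_trans mt.
have addI : additive_over small [set a | [set: X a] !=set0].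
  apply: (@additive_fibers _ _ sub _ _ t _ (below m)).
  - exact: addd.
  - by move=> a _; have [] := tE a.
  - move=> s _.
    have [->|/set0P[a [[x _] ta]]] :=
      eqVneq ([set a | [set: X a] !=set0] `&` t @^-1` [set s]) set0.
      by move=> F _; rewrite bigcup_set0.
    apply: addd; apply: card_le_trans (XC a).1; apply: card_le_trans (Xmult a).
    apply: (@injective_card_le _ _ _ _ (fun b => (x, b))) => [b [_ tb]|b b' _ _ [] //].
    split => //=; apply: card_eq_trans (tE a).2; rewrite card_eq_sym ta -tb.
    by have [] := tE b.
have addY : additive_over small [set: {a & X a}].
  apply: (@additive_fibers _ _ sub _ _ tag _ [set a | [set: X a] !=set0]) => //.
    by move=> [a x] _; exists x.
  move=> a _; apply: (@additive_sub _ _ sub zero _ _ (existT X a @` setT)).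
    by move=> [b x] [_ /= ba]; subst b; exists x.
  by apply: additive_image; apply: addd; have [] := XC a.
have addE := additive_seq sub zero addN (additive_setX sub zero addY
  (@additive_countable _ _ sub zero addN _ [set: rat * rat])).
have [||l0 _ nl0] := @not_small_fiber _ small sub _ _ [set: k]
  (fun i s => l i = s) addE.
- exact: cardinal_initial.
- by move=> i _; exists (l i).
have [i li] : exists i, l i = l0.
  apply: contrapT => ni; apply: nl0; apply: sub zero => j [_ lj].
  by apply: ni; exists j.
exists i => lc; apply: nl0; apply: (@sub _ [set j | l j = l i]).
  by move=> j [_ /= ->].
by apply: (card_le_trans lc); exact: subset_card_le.
Qed.

Theorem proposition8p10 (R : realType) (lambda : cardinal)
  (X : lambda -> topologicalType)
  (X_tychonoff : forall alpha, tychonoff_space (X alpha))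
  (calibers_X : forall alpha (k : cardinal),
    calibers (Cp R (X alpha)) k <->
    infinite_cardinal k /\ cofinality_gt k [set: X alpha])
  (X_homeo : forall alpha beta,
    [set: X alpha] #= [set: X beta] -> homeomorphic (X alpha) (X beta))
  (X_mult : forall alpha,
    [set: X alpha] `*` [set gamma | [set: X gamma] #= [set: X alpha]]
      #= [set: X alpha]) :
  forall k : cardinal, infinite_cardinal k ->
    (calibers (Cp R {alpha & X alpha}) k <->
     forall alpha, calibers (Cp R (X alpha)) k).
Proof.
move=> k kinf; split=> [cal a|cal]; first exact: calibers_restriction.
apply/calibers_self; split => // U oU.
have [Y0|/set0P[[a0 x0] _]] := eqVneq [set: {alpha & X alpha}] set0.
  have [i0 _] := infinite_setN0 kinf; have [_ [f _]] := oU i0.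
  exists setT, f; split => // i _; have [_ [g Ug]] := oU i.
  suff -> : f = g by [].
  apply: val_inj; apply/funext => y; exfalso.
  by have : [set: {alpha & X alpha}] y by []; rewrite Y0.
have [_ [C cofC _]] := (calibers_X a0 k).1 (cal a0).
have uncC := uncountable_cofinality x0 (cal a0) cofC.
have XC a : [set: X a] #<= C /\ ~ (C #<= [set: X a]).
  have [_ [Ca [Cacof Camin] [XCa nCaX]]] := (calibers_X a k).1 (cal a).
  split; first by apply: (card_le_trans XCa); apply: Camin; have [] := cofC.
  move=> CX; apply: nCaX; apply: card_le_trans CX; apply: Camin.
  by have [] := cofC.
have uncX a : ~ (C #<= [set: X a]) by have [] := XC a.
have /choice[f fU] := fun i => (oU i).2.
have /choice[l lE] := fun i => in_box_nbhs (oU i).1 (fU i).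
have [kC|nkC] := pselect ([set: k] #<= C).
  have [D [h [Dcof /Cp_of[g gh] hl]]] := cofinal_common_function
    cofC uncC uncX (fun i => @Cp_fun_continuous _ _ (f i)) (fun i => (lE i).1).
  exists D, g; split; last by move=> i Di; apply: (lE i).2; rewrite gh; exact: hl.
  by apply: (card_le_trans kC); exact: cofC.2.
have Xmult a : [set: X a] `*` [set b | [set: X b] #= [set: X a]] #<= [set: X a].
  by have := X_mult a; rewrite card_eq_le => /andP[].
have /choice[i_ iE] := constant_on_large_sets l cofC nkC uncC XC Xmult.
have [D [h [Dcof /Cp_of[g gh] hl]]] := cofinal_common_function (l := l \o i_)
  cofC uncC uncX (fun c => @Cp_fun_continuous _ _ (f (i_ c)))
  (fun c => (lE (i_ c)).1).
exists [set i | exists2 c, D c & l i = l (i_ c)], g; split; last first.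
  by move=> i [c Dc lic]; apply: (lE i).2; rewrite gh lic; exact: hl.
have [//|[x]] := card_segment k [set i | exists2 c, D c & l i = l (i_ c)].
rewrite card_eq_le => /andP[_ Jx]; have [c Dc xc] := Dcof x.
exfalso; apply: (iE c).
apply: (@card_le_trans _ _ _ [set i | exists2 c, D c & l i = l (i_ c)]).
  by apply: subset_card_le => j lj; exists c.
apply: (card_le_trans Jx); apply: subset_card_le => y yx; exact: lt_le_trans xc.
Qed.
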